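(* Let $a,b$ be integers with $a\ne b$. Then the equation $ax=by$ (in the variables $x,y$) is not $2$-regular.
   Context: For a positive integer $N$ let $[N]=\{1,\dots,N\}$. A linear homogeneous equation $\mathcal{E}$ is $c$-regular if there exists a positive integer $N$ such that every $c$-coloring of $[N]$ contains a monochromatic solution to $\mathcal{E}$, i.e. a solution whose variables all take values in $[N]$ (not necessarily distinct) having the same color. *)

(* Defs.v *)
From mathcomp Require Import all_boot all_order all_algebra.

Set Implicit Arguments.
Unset Strict Implicit.
Unset Printing Implicit Defensive.

Import Order.TTheory GRing.Theory Num.Theory.
Local Open Scope ring_scope.

Definition interval (N : nat) : Type := {n : nat | (0 < n <= N)%N}.

(* The tuple e encodes the linear homogeneous equation
   e_0 x_0 + ... + e_(k-1) x_(k-1) = 0 with integer coefficients. *)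
Definition lin_eq (k : nat) : Type := k.-tuple int.

Definition solution (k : nat) (e : lin_eq k) (x : 'I_k -> int) : Prop :=
  \sum_(i < k) tnth e i * x i = 0.

Definition monochromatic (N c k : nat) (chi : interval N -> 'I_c)
    (x : 'I_k -> interval N) : Prop :=
  exists col : 'I_c, forall i : 'I_k, chi (x i) = col.

Definition regular (c k : nat) (e : lin_eq k) : Prop :=
  exists N : nat, (0 < N)%N /\
    forall chi : interval N -> 'I_c,
      exists x : 'I_k -> interval N,
        solution e (fun i => (val (x i))%:Z) /\ monochromatic chi x.

(* The equation a x = b y, i.e. a x + (- b) y = 0. *)
Definition eq_ax_by (a b : int) : lin_eq 2 := [tuple a; - b].

Lemma solution_eq_ax_by (a b : int) (x : 'I_2 -> int) :
  solution (eq_ax_by a b) x <-> a * x ord0 = b * x ord_max.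
Proof.
rewrite /solution big_ord_recl big_ord1 !(tnth_nth 0) /= mulNr.
rewrite (_ : lift ord0 ord0 = ord_max); last exact: val_inj.
by split=> [/eqP|->]; rewrite ?subrr // subr_eq0 => /eqP.
Qed.

(* Main.v *)
(** If [ab = 0], or if [|a| = |b|], i.e. [a = - b], the equation has no positive
    solution at all.  Otherwise pick a prime [p] with [v_p(a) <> v_p(b)] and put
    [d = |v_p(a) - v_p(b)|].  In every positive solution of [a x = b y] the
    valuations [v_p(x)] and [v_p(y)] differ by exactly [d], so colouring [n] by
    the parity of [floor (v_p(n) / d)] separates [x] from [y]. *)
Require Import Defs.
From mathcomp Require Import all_boot all_order all_algebra.
From mathcomp Require Import zify.

(** Truncated subtraction makes [d] the distance from [u] to [v], hence also from [m] to [n], so the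
    quotients by [d] are consecutive. *)
Lemma odd_divn_dist (u v m n : nat) (d := (u - v) + (v - u)) :
  u != v -> u + m = v + n -> odd (m %/ d) != odd (n %/ d).
Proof.
move=> neq_uv eq_uv.
have d_gt0 : 0 < d by rewrite /d; lia.
have odd_shift k : odd ((k + d) %/ d) = ~~ odd (k %/ d).
  by rewrite divnDr // divnn d_gt0 addn1.
have [-> | ->] : m = n + d \/ n = m + d by rewrite /d; lia.
  by rewrite odd_shift; case: odd.
by rewrite odd_shift; case: odd.
Qed.

Lemma logn_parity_neq (p a b x y : nat)
    (d := (logn p a - logn p b) + (logn p b - logn p a)) :
  0 < a -> 0 < b -> 0 < x -> 0 < y -> a * x = b * y ->
  logn p a != logn p b ->
  odd (logn p x %/ d) != odd (logn p y %/ d).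
Proof.
move=> a_gt0 b_gt0 x_gt0 y_gt0 eq_ab neq_ab.
by apply: odd_divn_dist; rewrite // -!lognM // eq_ab.
Qed.

Lemma regular_eq_ax_by_solution (a b : int) (f : nat -> bool) :
  regular 2 (eq_ax_by a b) ->
  exists x y : nat,
    [/\ 0 < x, 0 < y, (a * x%:Z = b * y%:Z)%R & f x = f y].
Proof.
case=> N [_ reg].
have [x [/solution_eq_ax_by eq_ab [col chi_x]]] :=
  reg (fun n => inord (f (val n)) : 'I_2).
exists (val (x ord0)), (val (x ord_max)); split=> //.
- by case/andP: (valP (x ord0)).
- by case/andP: (valP (x ord_max)).
have := congr1 val (etrans (chi_x ord0) (esym (chi_x ord_max))).
by rewrite /= !inordK ?ltnS ?leq_b1 //; do 2!case: (f _).
Qed.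

Theorem theorem3p12 (a b : int) (hab : a <> b) :
  ~ regular 2 (eq_ax_by a b).
Proof.
move=> reg.
(* A constant colouring serves only to produce a positive solution; with [hab] it excludes [a = 0],
   [b = 0] and [a = - b]. *)
have [x [y [x_gt0 y_gt0 eq_ab _]]] := regular_eq_ax_by_solution _ _ xpredT reg.
have a_gt0 : 0 < `|a|%N by nia.
have b_gt0 : 0 < `|b|%N by nia.
suff eq_abs : `|a|%N = `|b|%N by nia.
apply: eqn_from_log => // p; apply/eqP/negPn/negP => neq_log.
pose d := (logn p `|a|%N - logn p `|b|%N) + (logn p `|b|%N - logn p `|a|%N).
(* Absolute values turn the equation into one between positive naturals, where [logn] is
   additive. *)
have [x' [y' [x'_gt0 y'_gt0 /(congr1 absz)]]] :=
  regular_eq_ax_by_solution _ _ (fun n => odd (logn p n %/ d)) reg.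
rewrite !abszM !absz_nat => eq_abs /eqP.
by apply/negP; apply: logn_parity_neq eq_abs neq_log.
Qed.
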